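(* (i) Let $f:M\twoheadrightarrow N$ be an epimorphism of p.f.d. persistence modules. For $t\in\mathbb R$, we have $$D^{\twoheadrightarrow}(f)_t=\left\{(i,j)\in\mathbb N^2\mid j\le\dim N_t,\ i=j+\max\{\operatorname{rank}M_{s,t}-\operatorname{rank}N_{s,t}\mid s<t,\ \operatorname{rank}N_{s,t}<j\}\right\}.$$ (ii) Let $f:M\hookrightarrow N$ be a monomorphism of p.f.d. persistence modules. For $t\in\mathbb R$, we have $$D^{\hookrightarrow}(f)_t=\left\{(i,j)\in\mathbb N^2\mid i\le\dim M_t,\ j=i+\max\{\operatorname{rank}N_{t,v}-\operatorname{rank}M_{t,v}\mid v>t,\ \operatorname{rank}M_{t,v}<i\}\right\}.$$ Here the maximum over an empty set is taken to be $0$.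
   Context: $\mathbb N=\{1,2,3,\dots\}$. Fix a field $K$. A pointwise finite dimensional (p.f.d.) persistence module is a functor $M$ from the poset category $\mathbf R$ of real numbers to finite dimensional $K$-vector spaces, with internal maps $M_{s,t}:M_s\to M_t$ for $s\le t$; morphisms are natural transformations. An interval is a non-empty set $I\subseteq\mathbb R$ such that $a,c\in I$ and $a<b<c$ imply $b\in I$. $\mathcal B(M)$ is the barcode of $M$: the unique multiset of intervals, represented as a set of pairs $(I,n)$ with $n\in\mathbb N$ where the indices $n$ of each $I$ form a prefix of $\mathbb N$, such that $M\cong\bigoplus_{I\in\mathcal B(M)}K^I$; here $K^I$ is $K$ at indices in $I$, $0$ elsewhere, with identity internal maps between indices in $I$. An element $(I,n)$ is usually written $I$. A matching is a partial injective function, viewed as a relation; matchings are composed as relations. Induced matchings: intervals $I,J$ coincide above if for all $s\in J$ there is $t\in I$ with $s\le t$ and vice versa; they coincide below if for all $t\in I$ there is $s\in J$ with $s\le t$ and vice versa. For a class $e$ of intervals under one of these equivalence relations, let $\mathcal B(M)^e$ be the set of elements of $\mathcal B(M)$ whose interval is in $e$, totally ordered by $(I,n)<(J,n')$ if $I\supsetneq J$, or $I=J$ and $n<n'$; this is isomorphic to a prefix of $\mathbb N$. For a monomorphism $f:M\hookrightarrow N$, $\mathcal X(f):\mathcal B(M)\to\mathcal B(N)$ sends, for each class $e$ under coinciding above, the $i$th element of $\mathcal B(M)^e$ to the $i$th element of $\mathcal B(N)^e$ (here $|\mathcal B(M)^e|\le|\mathcal B(N)^e|$). For an epimorphism $f:M\twoheadrightarrow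 N$, $\mathcal X(f)$ matches, for each class $e$ under coinciding below and each $i\le|\mathcal B(N)^e|$, the $i$th element of $\mathcal B(M)^e$ with the $i$th element of $\mathcal B(N)^e$ (here $|\mathcal B(N)^e|\le|\mathcal B(M)^e|$). For $t\in\mathbb R$ let $E(\mathcal B(M))_t=\{I\in\mathcal B(M)\mid t\in I\}$, and let $E(\mathcal X(f))_t=\{(I,J)\in\mathcal X(f)\mid t\in I\cap J\}$, a matching $E(\mathcal B(M))_t\to E(\mathcal B(N))_t$. Definition of $D^{\twoheadrightarrow}(f)_t$ for an epimorphism $f:M\twoheadrightarrow N$: order intervals lexicographically, first by increasing lower bound, then (for the same lower bound) by decreasing upper bound; lower and upper bounds here distinguish open and closed ends (e.g. $[0,3]<[1,2]<(1,3]<(1,2]$), and copies of the same interval are ordered by index. Enumerating in this order the intervals containing $t$ gives bijections $g_t:E(\mathcal B(M))_t\to\{1,\dots,\dim M_t\}$ and $h_t:E(\mathcal B(N))_t\to\{1,\dots,\dim N_t\}$. Set $D^{\twoheadrightarrow}(f)_t:=h_t\circ E(\mathcal X(f))_t\circ g_t^{-1}$. Definition of $D^{\hookrightarrow}(f)_t$ for a monomorphism $f$: the same construction with intervals ordered lexicographically first by decreasing upper bound, then by increasing lower bound (copies again ordered by index). *)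

(* Defs.v *)
From HB Require Import structures.
From mathcomp Require Import all_boot all_order all_algebra.
From mathcomp Require Import all_classical all_reals all_analysis.

Set Implicit Arguments.
Unset Strict Implicit.
Unset Printing Implicit Defensive.

Import Order.TTheory GRing.Theory Num.Theory.

Local Open Scope classical_set_scope.
Local Open Scope ring_scope.

(* Pointwise finite dimensional persistence modules.  Since [s <= t] is a
   boolean, the internal map does not depend on the proof of [s <= t]. *)
Record pmodule (R : realType) (K : fieldType) := PModule {
  pspace :> R -> vectType K;
  pmap : forall s t : R, s <= t -> 'Hom(pspace s, pspace t);
  pmap_id : forall (t : R) (tt : t <= t), pmap tt = \1%VF;
  pmap_comp : forall (s t u : R) (st : s <= t) (tu : t <= u) (su : s <= u),
    pmap su = (pmap tu \o pmap st)%VF }.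

Record pmorphism (R : realType) (K : fieldType) (M N : pmodule R K) :=
  PMorphism {
  pmor :> forall t : R, 'Hom(M t, N t);
  pmor_natural : forall (s t : R) (st : s <= t),
    (pmor t \o pmap M st)%VF = (pmap N st \o pmor s)%VF }.

Definition epimorphism (R : realType) (K : fieldType) (M N : pmodule R K)
    (f : pmorphism M N) : Prop :=
  forall (P : pmodule R K) (g h : pmorphism N P),
    (forall t, (g t \o f t)%VF = (h t \o f t)%VF) -> forall t, g t = h t.

Definition monomorphism (R : realType) (K : fieldType) (M N : pmodule R K)
    (f : pmorphism M N) : Prop :=
  forall (P : pmodule R K) (g h : pmorphism P M),
    (forall t, (f t \o g t)%VF = (f t \o h t)%VF) -> forall t, g t = h t.

Definition prank (R : realType) (K : fieldType) (M : pmodule R K)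
  (s t : R) (st : s <= t) : nat := \dim (limg (pmap M st)).

Record rinterval (R : realType) := RInterval {
  rset :> set R;
  rset_neq0 : rset !=set0;
  rset_itv : is_interval rset }.

(* An element (I, n) of a barcode; the indices n start at 1. *)
Definition bar (R : realType) : Type := (rinterval R * nat)%type.

(* The interval module K^I: its spaces, as subsets of K, and its maps. *)
Definition itv_space (R : realType) (K : fieldType) (I : rinterval R) (t : R) :
    set K :=
  if t \in (I : set R) then [set: K] else [set 0].

Definition itv_map (R : realType) (K : fieldType) (I : rinterval R) (s t : R)
    (x : K) : K :=
  if (s \in (I : set R)) && (t \in (I : set R)) then x else 0.

(* The direct sum of the K^I over a set B of bars: its elements at t are the
   finitely supported families in the product of the (K^I)_t, extended by 0
   outside B; its internal maps act componentwise. *)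
Definition dsum_space (R : realType) (K : fieldType) (B : set (bar R)) (t : R) :
    set (bar R -> K^o) :=
  [set v | [/\ forall b, B b -> itv_space b.1 t (v b),
               forall b, ~ B b -> v b = 0
             & finite_set [set b | v b != 0]]].

Definition dsum_map (R : realType) (K : fieldType) (s t : R)
    (v : bar R -> K^o) : bar R -> K^o :=
  fun b => itv_map b.1 s t (v b).

Definition iso_dsum (R : realType) (K : fieldType) (M : pmodule R K)
    (B : set (bar R)) : Prop :=
  exists phi : forall t : R, {linear M t -> (bar R -> K^o)},
    (forall t, set_bij [set: M t] (dsum_space B t) (phi t)) /\
    (forall (s t : R) (st : s <= t) (x : M s),
       phi t (pmap M st x) = dsum_map s t (phi s x)).

Definition is_barcode (R : realType) (K : fieldType) (M : pmodule R K)
    (B : set (bar R)) : Prop :=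
  [/\ forall I n, B (I, n) -> (0 < n)%N,
      forall I m n, (0 < m <= n)%N -> B (I, n) -> B (I, m)
    & iso_dsum M B].

Definition coincide_above (R : realType) (I J : rinterval R) : Prop :=
  (forall s, rset J s -> exists2 t, rset I t & s <= t) /\
  (forall s, rset I s -> exists2 t, rset J t & s <= t).

Definition coincide_below (R : realType) (I J : rinterval R) : Prop :=
  (forall t, rset I t -> exists2 s, rset J s & s <= t) /\
  (forall t, rset J t -> exists2 s, rset I s & s <= t).

(* B(M)^e *)
Definition bars_in (R : realType) (B : set (bar R)) (e : set (rinterval R)) :
  set (bar R) := [set b | B b /\ e b.1].

(* E(B(M))_t *)
Definition bars_at (R : realType) (B : set (bar R)) (t : R) : set (bar R) :=
  [set b | B b /\ rset b.1 t].

(* [x] is the [i]th element (counting from 1) of [S] in the total order with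
   strict part [lt]. *)
Definition is_ith (T : Type) (lt : T -> T -> Prop) (S : set T) (i : nat)
    (x : T) : Prop :=
  S x /\ ([set y | S y /\ (y = x \/ lt y x)] #= `I_i)%card.

Definition bar_lt (R : realType) (b c : bar R) : Prop :=
  (rset c.1 `<` rset b.1) \/ (b.1 = c.1 /\ (b.2 < c.2)%N).

(* The induced matchings depend on the mono- or epimorphism only through the
   barcodes of its source and target. *)
Definition X_mono (R : realType) (BM BN : set (bar R)) : set (bar R * bar R) :=
  [set p | exists (I : rinterval R) (i : nat),
     is_ith (@bar_lt R) (bars_in BM (coincide_above I)) i p.1 /\
     is_ith (@bar_lt R) (bars_in BN (coincide_above I)) i p.2].

Definition X_epi (R : realType) (BM BN : set (bar R)) : set (bar R * bar R) :=
  [set p | exists (I : rinterval R) (i : nat),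
     is_ith (@bar_lt R) (bars_in BM (coincide_below I)) i p.1 /\
     is_ith (@bar_lt R) (bars_in BN (coincide_below I)) i p.2].

(* E(X)_t *)
Definition match_at (R : realType) (X : set (bar R * bar R)) (t : R) :
    set (bar R * bar R) :=
  [set p | [/\ X p, rset p.1.1 t & rset p.2.1 t]].

(* Bounds in [itv_bound R] are -oo, +oo or a real together with a side, with
   [a < ]a as lower bounds and a[ < a] as upper bounds. *)
Definition lower_bound (R : realType) (I : rinterval R) : itv_bound R :=
  let: Interval a _ := Rhull I in a.

Definition upper_bound (R : realType) (I : rinterval R) : itv_bound R :=
  let: Interval _ b := Rhull I in b.

Definition epi_lt (R : realType) (b c : bar R) : Prop :=
  (lower_bound b.1 < lower_bound c.1)%O \/
  (lower_bound b.1 = lower_bound c.1 /\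
    ((upper_bound c.1 < upper_bound b.1)%O \/
     (upper_bound b.1 = upper_bound c.1 /\ (b.2 < c.2)%N))).

Definition mono_lt (R : realType) (b c : bar R) : Prop :=
  (upper_bound c.1 < upper_bound b.1)%O \/
  (upper_bound b.1 = upper_bound c.1 /\
    ((lower_bound b.1 < lower_bound c.1)%O \/
     (lower_bound b.1 = lower_bound c.1 /\ (b.2 < c.2)%N))).

(* The composite of relations h_t o E(X)_t o g_t^-1, where g_t and h_t
   enumerate the bars at t in the order [lt]. *)
Definition enum_match (R : realType) (lt : bar R -> bar R -> Prop)
    (BM BN : set (bar R)) (X : set (bar R * bar R)) (t : R) :
    set (nat * nat) :=
  [set ij | exists b c : bar R,
     [/\ is_ith lt (bars_at BM t) ij.1 b,
         match_at X t (b, c)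
       & is_ith lt (bars_at BN t) ij.2 c]].

Definition D_epi (R : realType) (BM BN : set (bar R)) (t : R) :
    set (nat * nat) :=
  enum_match (@epi_lt R) BM BN (X_epi BM BN) t.

Definition D_mono (R : realType) (BM BN : set (bar R)) (t : R) :
    set (nat * nat) :=
  enum_match (@mono_lt R) BM BN (X_mono BM BN) t.

(* [m] is the maximum of [S], the maximum of the empty set being 0. *)
Definition is_max0 (S : set int) (m : int) : Prop :=
  (S = set0 /\ m = 0) \/ (S m /\ forall x, S x -> x <= m).

(* Main.v *)
(* For an epimorphism, sort the bars containing t by lower bound.  The number of
   those that contain a given s <= t is rank M_{s,t}, so the position of a bar is
   the number of bars starting strictly earlier plus its position among the bars
   with the same lower bound, and the latter is preserved by the matching.  Hence
   a bar at position j of N is matched with position j + d, where d counts the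
   bars of M starting strictly before it, minus those of N.  As f is pointwise
   surjective, f maps im M_{s,t} onto im N_{s,t}, so s |-> rank M_{s,t} - rank
   N_{s,t} is nondecreasing; and rank N_{s,t} < j exactly when s lies left of the
   j-th bar, so d is the stated maximum.  The same monotonicity shows that each
   class of equal lower bounds has at least as many bars in M as in N.  The
   monomorphism case is dual, with M and N exchanged and the reals reversed. *)

From HB Require Import structures.
From mathcomp Require Import all_boot all_order all_algebra finmap.
From mathcomp Require Import all_classical all_reals all_analysis.
From mathcomp Require Import zify lra.
(* Imported last: [pmap] must denote the internal maps, not the one of seq. *)
Require Import Defs.

Set Implicit Arguments.
Unset Strict Implicit.
Unset Printing Implicit Defensive.

Import Order.TTheory GRing.Theory Num.Theory.

Local Open Scope classical_set_scope.
Local Open Scope ring_scope.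

(** * Linear algebra *)

Lemma dim_limg_mono (K : fieldType) (V W : vectType K) (g : 'Hom(V, W))
    (A A' : {vspace V}) : (A <= A')%VS ->
  (\dim A + \dim (g @: A') <= \dim A' + \dim (g @: A))%N.
Proof.
move=> AA'; have := dimvS (capvS AA' (subvv (lker g))).
by have := limg_ker_dim g A; have := limg_ker_dim g A'; lia.
Qed.

(** * Pointwise surjectivity of epimorphisms and injectivity of monomorphisms *)

Section TestModule.
Variables (R : realType) (K : fieldType).

Definition step_map (V : vectType K) (p : R -> bool) (s t : R)
  & s <= t : 'Hom(V, V) := if p s == p t then \1%VF else 0.

Lemma step_map_id (V : vectType K) (p : R -> bool) (t : R) (tt : t <= t) :
  step_map V p tt = \1%VF.
Proof. by rewrite /step_map eqxx. Qed.

Lemma step_map_comp (V : vectType K) (p : R -> bool)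
    (p_up : forall s t, s <= t -> p s -> p t)
    (s t u : R) (st : s <= t) (tu : t <= u) (su : s <= u) :
  step_map V p su = (step_map V p tu \o step_map V p st)%VF.
Proof.
rewrite /step_map; have := p_up _ _ st; have := p_up _ _ tu.
case: (p s); case: (p t); case: (p u) => //= H1 H2;
  rewrite ?comp_lfun1l ?comp_lfun0l ?comp_lfun0r //.
- by have := H2 isT.
- by have := H1 isT.
Qed.

(* The constant module with value V, cut into its restrictions to the up-set p
   and to the complement of p. *)
Definition step_module (V : vectType K) (p : R -> bool)
    (p_up : forall s t, s <= t -> p s -> p t) :=
  PModule (@step_map_id V p) (step_map_comp V p_up).

Lemma gt_upward (t s u : R) : s <= u -> t < s -> t < u.
Proof. by move=> su ts; apply: lt_le_trans su. Qed.

Lemma ge_upward (t s u : R) : s <= u -> t <= s -> t <= u.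
Proof. by move=> su ts; apply: le_trans su. Qed.

(** Any linear map out of [N t] becomes a test morphism by precomposing with the maps into [t].
    Naturality across [t] costs nothing: the step module has zero maps there. *)
Lemma to_step_module (N : pmodule R K) (t : R) (V : vectType K)
    (phi : 'Hom(N t, V)) :
  exists g : pmorphism N (step_module V (@gt_upward t)),
    (forall s (st : s <= t), g s = (phi \o pmap N st)%VF) /\
    (forall s, t < s -> g s = 0).
Proof.
pose g s : 'Hom(N s, V) := match pselect (s <= t) with
  | left st => (phi \o pmap N st)%VF | _ => 0 end.
have gle s (st : s <= t) : g s = (phi \o pmap N st)%VF.
  rewrite /g; case: pselect => [st'|//].
  by rewrite (bool_irrelevance st st').
have ggt s : t < s -> g s = 0.
  by rewrite /g; case: pselect => // st; rewrite ltNge st.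
suff gnat s u (su : s <= u) :
    (g u \o pmap N su)%VF = (step_map V (fun s => t < s) su \o g s)%VF.
  by exists (@PMorphism R K N (step_module V (@gt_upward t)) g gnat).
rewrite /step_map; have [ut|tu] := leP u t.
  have st := le_trans su ut.
  rewrite (gle _ ut) (gle _ st) ltNge st /= comp_lfun1l -comp_lfunA.
  by rewrite (pmap_comp N su ut st).
rewrite (ggt _ tu) comp_lfun0l.
have [ts|st] := ltP t s; first by rewrite ggt // comp_lfun0r.
by rewrite comp_lfun0l.
Qed.

Lemma from_step_module (M : pmodule R K) (t : R) (V : vectType K)
    (phi : 'Hom(V, M t)) :
  exists g : pmorphism (step_module V (@ge_upward t)) M,
    (forall s (ts : t <= s), g s = (pmap M ts \o phi)%VF) /\
    (forall s, s < t -> g s = 0).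
Proof.
pose g s : 'Hom(V, M s) := match pselect (t <= s) with
  | left ts => (pmap M ts \o phi)%VF | _ => 0 end.
have gle s (ts : t <= s) : g s = (pmap M ts \o phi)%VF.
  rewrite /g; case: pselect => [ts'|//].
  by rewrite (bool_irrelevance ts ts').
have ggt s : s < t -> g s = 0.
  by rewrite /g; case: pselect => // st; rewrite ltNge st.
suff gnat s u (su : s <= u) :
    (g u \o step_map V (fun s => t <= s) su)%VF = (pmap M su \o g s)%VF.
  by exists (@PMorphism R K (step_module V (@ge_upward t)) M g gnat).
rewrite /step_map; have [ts|st] := leP t s.
  have tu := le_trans ts su.
  rewrite (gle _ tu) (gle _ ts) tu /= comp_lfun1r comp_lfunA.
  by rewrite (pmap_comp M ts su tu).
rewrite (ggt _ st) comp_lfun0r.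
have [tu|ut] := leP t u; last by rewrite ggt // comp_lfun0l.
by rewrite comp_lfun0r.
Qed.

(** The projection onto the image [U] and the identity of [N t] induce two test morphisms. They
    agree after [f], because by naturality everything coming through [f] lands in [U] at [t].
    Cancelling [f] makes the projection the identity. *)
Lemma epi_surjective (M N : pmodule R K) (f : pmorphism M N) (t : R) :
  epimorphism f -> limg (f t) = fullv.
Proof.
move=> fepi; set U := limg (f t).
have [g [gle ggt]] := to_step_module (projv U).
have [h [hle hgt]] := to_step_module (\1%VF : 'Hom(N t, N t)).
have /fepi/(_ t) : forall s, (g s \o f s)%VF = (h s \o f s)%VF.
  move=> s; have [st|ts] := leP s t; last by rewrite ggt // hgt.
  rewrite (gle _ st) (hle _ st) -!comp_lfunA -pmor_natural comp_lfun1l.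
  apply/lfunP => x; rewrite !comp_lfunE projv_id //.
  by rewrite memv_img ?memvf.
rewrite (gle _ (lexx t)) (hle _ (lexx t)) !pmap_id !comp_lfun1r => E.
by rewrite -(limg_proj U) E lim1g.
Qed.

(** Dually, the projection onto the kernel and the zero map induce test morphisms into [M] that [f]
    cannot tell apart. *)
Lemma mono_injective (M N : pmodule R K) (f : pmorphism M N) (t : R) :
  monomorphism f -> lker (f t) == 0%VS.
Proof.
move=> fmono; set U := lker (f t).
have [g [gge glt]] := from_step_module (projv U).
have [h [hge hlt]] := from_step_module (0 : 'Hom(M t, M t)).
have /fmono/(_ t) : forall s, (f s \o g s)%VF = (f s \o h s)%VF.
  move=> s; have [ts|st] := leP t s; last by rewrite glt // hlt.
  rewrite (gge _ ts) (hge _ ts) !comp_lfunA pmor_natural comp_lfun0r.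
  apply/lfunP => x; rewrite !comp_lfunE lfunE /=.
  have /eqP -> : f t (projv U x) == 0 by rewrite -memv_ker memv_proj.
  by rewrite linear0.
rewrite (gge _ (lexx t)) (hge _ (lexx t)) !pmap_id !comp_lfun1l => E.
by rewrite -(limg_proj U) E lim0g.
Qed.

End TestModule.

(** * Rank inequalities for epimorphisms and monomorphisms *)

Section Ranks.
Variables (R : realType) (K : fieldType) (M N : pmodule R K).
Variable f : pmorphism M N.

Lemma dim_prank (P : pmodule R K) (t : R) (tt : t <= t) :
  prank P tt = \dim {:P t}.
Proof. by rewrite /prank pmap_id lim1g. Qed.

Lemma limg_pmap_sub (P : pmodule R K) (s s' t : R) (ss' : s <= s')
    (st : s <= t) (s't : s' <= t) : (limg (pmap P st) <= limg (pmap P s't))%VS.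
Proof. by rewrite (pmap_comp P ss' s't st) limg_comp limgS ?subvf. Qed.

(** Surjectivity of [f s] lets [M s] replace [N s] as the source, and naturality then moves [f] past
    the internal map. *)
Lemma epi_limg (s t : R) (st : s <= t) : epimorphism f ->
  limg (pmap N st) = (f t @: limg (pmap M st))%VS.
Proof.
move=> fepi.
by rewrite -[in LHS](epi_surjective s fepi) -!limg_comp pmor_natural.
Qed.

Lemma epi_prank_le (s t : R) (st : s <= t) : epimorphism f ->
  (prank N st <= prank M st)%N.
Proof.
by move=> fepi; rewrite /prank epi_limg // -(limg_ker_dim (f t)) leq_addl.
Qed.

(** The rank difference at [s] is the dimension of the kernel of [f t] inside the image of M_{s,t},
    and this image grows with [s]. The sum form avoids truncated subtraction. *)
Lemma epi_prank_mono (s s' t : R) (ss' : s <= s') (st : s <= t)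
    (s't : s' <= t) : epimorphism f ->
  (prank M st + prank N s't <= prank M s't + prank N st)%N.
Proof.
by move=> fepi; rewrite /prank !epi_limg // dim_limg_mono ?limg_pmap_sub.
Qed.

Lemma mono_limg_sub (s t : R) (st : s <= t) :
  (f t @: limg (pmap M st) <= limg (pmap N st))%VS.
Proof. by rewrite -limg_comp pmor_natural limg_comp limgS ?subvf. Qed.

Lemma mono_dim_limg (t : R) (U : {vspace M t}) : monomorphism f ->
  \dim (f t @: U) = \dim U.
Proof.
move=> fmono; apply: limg_dim_eq.
by rewrite (eqP (mono_injective t fmono)) capv0.
Qed.

Lemma mono_prank_le (s t : R) (st : s <= t) : monomorphism f ->
  (prank M st <= prank N st)%N.
Proof.
move=> fmono; rewrite /prank -(mono_dim_limg (limg (pmap M st)) fmono).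
exact/dimvS/mono_limg_sub.
Qed.

(** The rank lost from [v] to [v'] is the dimension of the part of the image at [v] killed on the
    way to [v']. The injective map [f v] embeds this part for [M] into the one for [N]. *)
Lemma mono_prank_mono (t v v' : R) (vv' : v <= v') (tv : t <= v)
    (tv' : t <= v') : monomorphism f ->
  (prank N tv' + prank M tv <= prank N tv + prank M tv')%N.
Proof.
move=> fmono; rewrite /prank (pmap_comp M tv vv' tv') (pmap_comp N tv vv' tv').
rewrite !limg_comp.
rewrite -(limg_ker_dim (pmap M vv') (limg (pmap M tv))).
rewrite -(limg_ker_dim (pmap N vv') (limg (pmap N tv))).
suff : (\dim (limg (pmap M tv) :&: lker (pmap M vv'))
        <= \dim (limg (pmap N tv) :&: lker (pmap N vv')))%N by lia.
rewrite -[X in (X <= _)%N](mono_dim_limg _ fmono); apply: dimvS.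
apply: subv_trans (limg_cap _ _ _) _; apply: capvS; first exact: mono_limg_sub.
(* By naturality, N_{v,v'} kills the image under [f v] of the kernel of M_{v,v'}. *)
by rewrite lkerE -limg_comp -pmor_natural limg_comp; apply/eqP;
  move: (subvv (lker (pmap M vv'))); rewrite lkerE => /eqP ->; rewrite limg0.
Qed.

End Ranks.

(** * Bars as basis vectors, and ranks as numbers of bars *)

HB.instance Definition _ (R : realType) := gen_eqMixin (rinterval R).
HB.instance Definition _ (R : realType) := gen_choiceMixin (rinterval R).

Section BarBasis.
Variables (R : realType) (K : fieldType) (M : pmodule R K) (B : set (bar R)).
Variable phi : forall t : R, {linear M t -> (bar R -> K^o)}.
Hypothesis phi_bij : forall t, set_bij [set: M t] (dsum_space B t) (phi t).
Hypothesis phi_map : forall (s t : R) (st : s <= t) (x : M s),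
  phi t (pmap M st x) = dsum_map s t (phi s x).

Lemma phi_inj t : injective (phi t).
Proof. by move=> x y; case: (phi_bij t) => _ + _; apply; rewrite inE. Qed.

Lemma phi_supp t x b : phi t x b != 0 -> bars_at B t b.
Proof.
case: (phi_bij t) => /(_ x I)[itv out _] _ _ xb0.
case: (pselect (B b)) => [Bb|/out xb]; last first.
  by rewrite xb eqxx in xb0.
split=> //; apply: contrapT => tb; move: (itv b Bb).
by rewrite /itv_space memNset //= => xb; rewrite xb eqxx in xb0.
Qed.

(** [x b] is the basis vector of [M t] coming from the summand of [b]: the indicator of a bar at [t]
    lies in the direct sum, so it has a preimage. Other bars get the dummy value 0. *)
Lemma bar_vectors t : exists x : bar R -> M t, forall b, bars_at B t b ->
  phi t (x b) = (fun c => (c == b)%:R).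
Proof.
suff /choice[x xE] : forall b, exists y, bars_at B t b ->
    phi t y = (fun c => (c == b)%:R) by exists x.
move=> b; case: (pselect (bars_at B t b)) => [[Bb bt]|]; last by exists 0.
case: (phi_bij t) => _ _ /(_ (fun c => (c == b)%:R)) [|x _ <-]; last by exists x.
split.
- move=> c Bc; rewrite /itv_space; have [->|cb] := eqVneq c b.
    by rewrite mem_set.
  by case: ifP.
- by move=> c nBc; case: eqP => // cb; rewrite cb in nBc.
- apply: (@sub_finite_set _ _ [set b]) => // c /=; case: (eqVneq c b) => // _.
  by rewrite eqxx.
Qed.

Lemma phi_span0 t (X : seq (M t)) b v :
  (forall y, y \in X -> phi t y b = 0) -> v \in <<X>>%VS -> phi t v b = 0.
Proof.
move=> X0 vX; rewrite (coord_span (X := in_tuple X) vX) linear_sum fct_sumE.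
rewrite big1 // => i _; rewrite linearZ /=.
have /X0 Xi : (in_tuple X)`_i \in X by rewrite mem_nth.
by rewrite scalrfctE Xi scaler0.
Qed.

Variables (t : R) (x : bar R -> M t).
Hypothesis xE : forall b, bars_at B t b -> phi t (x b) = (fun c => (c == b)%:R).

(** The coordinate at [b] vanishes on the vectors of all other bars, hence on their span, but equals
    1 on [x b]. *)
Lemma free_bar_vectors (A : seq (bar R)) : uniq A ->
  (forall b, b \in A -> bars_at B t b) -> free (map x A).
Proof.
elim: A => [|b A IH] /= => [_ _|/andP[bA uA] Abars]; first exact: nil_free.
rewrite free_cons IH // => [|c cA]; last by apply: Abars; rewrite inE cA orbT.
rewrite andbT; apply/negP => /(@phi_span0 _ _ b) xb0.
have : phi t (x b) b = 0.
  apply: xb0 => y /mapP[c cA ->]; rewrite xE; last first.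
    by apply: Abars; rewrite inE cA orbT.
  by case: eqP bA => // ->; rewrite cA.
by rewrite xE ?eqxx; [move/eqP; rewrite oner_eq0|apply: Abars; rewrite mem_head].
Qed.

(** Otherwise some free family would have more members than the dimension of [M t]. *)
Lemma bars_at_finite : finite_set (bars_at B t).
Proof.
apply: contrapT => /(infinite_set_fset (\dim {:M t}).+1)[A Abars].
apply/negP; rewrite -leqNgt.
have : free (map x (finmap.enum_fset A)).
  by apply: free_bar_vectors => [|b bA]; [exact: finmap.fset_uniq|exact: Abars].
by move=> /eqP; rewrite size_map => <-; apply/dimvS/subvf.
Qed.

(** The vectors [x b] of the bars containing both [s] and [t] form a basis of the image of
    M_{s,t}. *)
Lemma prank_bars (A : seq (bar R)) (s : R) (st : s <= t) : uniq A ->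
    (forall b, b \in A <-> bars_at B t b /\ rset b.1 s) ->
  prank M st = size A.
Proof.
move=> uA AE; have fA : free (map x A).
  by apply: free_bar_vectors => // b /AE[].
rewrite -(size_map x) -(eqP fA) /prank; congr (\dim _); apply/eqP.
rewrite eqEsubv; apply/andP; split.
  apply/subvP => _ /memv_imgP[y _ ->].
  (* An image vector has no coordinate outside [A], since the direct sum kills every bar that misses
     [s] or [t]. *)
  suff -> : pmap M st y = \sum_(b <- A) phi t (pmap M st y) b *: x b.
    rewrite big_seq; apply: rpred_sum => b bA; apply: rpredZ.
    by rewrite memv_span ?map_f.
  apply: (@phi_inj t); apply/funext => c; rewrite linear_sum fct_sumE.
  rewrite (eq_big_seq (fun b => phi t (pmap M st y) b * (c == b)%:R)); last first.
    by move=> b /AE[bt _]; rewrite linearZ /= xE.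
  have [cA|cA] := boolP (c \in A).
    rewrite (bigD1_seq c) //= eqxx mulr1 big1 ?addr0 // => b.
    by rewrite eq_sym => /negPf ->; rewrite mulr0.
  rewrite big_seq big1 => [|b bA]; last first.
    by case: eqP cA => [->|]; rewrite ?bA ?mulr0.
  apply: contraNeq cA => pc; apply/AE; split.
    exact: phi_supp pc.
  move: pc; rewrite phi_map /dsum_map /itv_map.
  by case: ifP; rewrite ?eqxx // => /andP[/set_mem].
apply/span_subvP => _ /mapP[b /AE[bt bs] ->].
(* Conversely, [x b] is the image of the basis vector of the same bar at [s]. *)
have [x' x'E] := bar_vectors s.
suff -> : x b = pmap M st (x' b) by rewrite memv_img ?memvf.
apply: (@phi_inj t); rewrite phi_map xE // x'E; last by case: bt.
apply/funext => c; rewrite /dsum_map /itv_map.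
case: eqP => [->|_]; last by case: ifP.
by case: bt => _ bt; rewrite !mem_set.
Qed.

End BarBasis.

(** * Ranks read off a barcode *)

Section Barcode.
Variables (R : realType) (K : fieldType) (M : pmodule R K) (B : set (bar R)).
Hypothesis barM : is_barcode M B.

Lemma barcode_bars_at (t : R) :
  exists2 A : seq (bar R), uniq A & forall b, b \in A <-> bars_at B t b.
Proof.
case: barM => _ _ [phi [phi_bij _]].
have [x xE] := bar_vectors phi_bij t.
have /finite_seqP[A AE] := bars_at_finite xE.
exists (undup A); rewrite ?undup_uniq // => b; rewrite mem_undup.
by rewrite AE.
Qed.

Lemma barcode_prank (s t : R) (st : s <= t) (A : seq (bar R)) : uniq A ->
    (forall b, b \in A <-> bars_at B t b /\ rset b.1 s) -> prank M st = size A.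
Proof.
case: barM => _ _ [phi [phi_bij phi_map]] uA AE.
have [x xE] := bar_vectors phi_bij t.
exact: (prank_bars phi_bij phi_map xE).
Qed.

End Barcode.

(** * Bounds of intervals, orders on bars, and coincidence *)

Section Bounds.
Variable R : realType.
Implicit Types (I J : rinterval R) (b c : bar R) (s t : R).

Lemma rset_bounds I s :
  rset I s <-> (lower_bound I <= BLeft s)%O /\ (BRight s <= upper_bound I)%O.
Proof.
have -> : rset I s = (s \in Rhull I) :> Prop.
  by have := @RhullK R (rset I); rewrite inE => /(_ (@rset_itv R I)) {1}<-.
rewrite /lower_bound /upper_bound; case: (Rhull I) => l u.
rewrite itv_boundlr; split; first by case/andP.
by case=> -> ->.
Qed.

Lemma rinterval_eq I J : lower_bound I = lower_bound J ->
  upper_bound I = upper_bound J -> I = J.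
Proof.
move=> lE uE; have : rset I = rset J.
  by apply/seteqP; split=> s /rset_bounds sE; apply/rset_bounds; move: sE;
    rewrite lE uE.
case: I J {lE uE} => [I I1 I2] [J J1 J2] /= E; subst J.
by congr RInterval; exact: Prop_irrelevance.
Qed.

(** This reduces comparing lower bounds, with their open and closed sides, to testing real
    parameters up to [t]. The midpoint is taken when [a] is open at [x] and [b] closed at [y], as
    then neither endpoint separates. *)
Lemma lower_sep (a b : itv_bound R) t : (a < b)%O -> (b <= BLeft t)%O ->
  exists2 s, s <= t & (a <= BLeft s)%O /\ (BLeft s < b)%O.
Proof.
case: b => [[] y|[]] //.
- case: a => [[] x|[]] // + yt.
  + by move=> xy; exists x; [move: xy yt; rewrite !bnd_simp; lra|rewrite lexx].
  + rewrite !bnd_simp => xy; exists ((x + y) / 2).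
      by move: yt; rewrite bnd_simp; lra.
    by rewrite !bnd_simp; split; lra.
  + by move=> _; exists (y - 1); move: yt; rewrite !bnd_simp; [|split]; lra.
- case: a => [[] x|[]] //; rewrite !bnd_simp => + yt.
  + by move=> xy; exists y; rewrite ?bnd_simp //; lra.
  + by move=> xy; exists y; rewrite ?bnd_simp //; lra.
  + by exists y; rewrite ?bnd_simp //; lra.
- by case: a => [[] ?|[]].
Qed.

Lemma upper_sep (a b : itv_bound R) t : (a < b)%O -> (BRight t <= a)%O ->
  exists2 s, t <= s & (a < BRight s)%O /\ (BRight s <= b)%O.
Proof.
case: a => [[] y|[]] //.
- case: b => [[] x|[]] //; rewrite !bnd_simp => + yt.
  + by move=> xy; exists y; rewrite ?bnd_simp //; lra.
  + by move=> xy; exists y; rewrite ?bnd_simp //; lra.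
  + by exists y; rewrite ?bnd_simp //; lra.
- case: b => [[] x|[]] // + yt.
  + rewrite !bnd_simp => xy; exists ((x + y) / 2).
      by move: yt; rewrite bnd_simp; lra.
    by rewrite !bnd_simp; split; lra.
  + by move=> xy; exists x; [move: xy yt; rewrite !bnd_simp; lra|rewrite lexx].
  + by move=> _; exists (y + 1); move: yt; rewrite !bnd_simp; [|split]; lra.
Qed.

Lemma epi_lt_irr b : ~ epi_lt b b.
Proof. by case=> [|[_ [|[_]]]]; rewrite ?ltxx ?ltnn. Qed.

Lemma epi_lt_trans c b d : epi_lt b c -> epi_lt c d -> epi_lt b d.
Proof.
rewrite /epi_lt => -[lbc|[-> [ubc|[-> nbc]]]] [lcd|[<- [ucd|[<- ncd]]]]; auto.
- by left; exact: lt_trans lcd.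
- by right; split=> //; left; exact: lt_trans ubc.
- by right; split=> //; right; split=> //; exact: ltn_trans ncd.
Qed.

Lemma epi_lt_total b c : b <> c -> epi_lt b c \/ epi_lt c b.
Proof.
move: b c => [I m] [J n] bc; rewrite /epi_lt /=.
case: (ltgtP (lower_bound I)) => [_|_|lE]; [by left; left|by right; left|].
case: (ltgtP (upper_bound I)) => [_|_|uE];
  [by right; right; split; auto|by left; right; split; auto|].
case: (ltngtP m n) => [_|_|mn]; [by left; auto|by right; auto|].
by case: bc; rewrite mn (rinterval_eq lE uE).
Qed.

Lemma mono_lt_irr b : ~ mono_lt b b.
Proof. by case=> [|[_ [|[_]]]]; rewrite ?ltxx ?ltnn. Qed.

Lemma mono_lt_trans c b d : mono_lt b c -> mono_lt c d -> mono_lt b d.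
Proof.
rewrite /mono_lt => -[ubc|[-> [lbc|[-> nbc]]]] [ucd|[<- [lcd|[<- ncd]]]]; auto.
- by left; exact: lt_trans ubc.
- by right; split=> //; left; exact: lt_trans lcd.
- by right; split=> //; right; split=> //; exact: ltn_trans ncd.
Qed.

Lemma mono_lt_total b c : b <> c -> mono_lt b c \/ mono_lt c b.
Proof.
move: b c => [I m] [J n] bc; rewrite /mono_lt /=.
case: (ltgtP (upper_bound I)) => [_|_|uE]; [by right; left|by left; left|].
case: (ltgtP (lower_bound I)) => [_|_|lE];
  [by left; right; split; auto|by right; right; split; auto|].
case: (ltngtP m n) => [_|_|mn]; [by left; auto|by right; auto|].
by case: bc; rewrite mn (rinterval_eq lE uE).
Qed.

Lemma coincide_below_sym I J : coincide_below I J -> coincide_below J I.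
Proof. by case. Qed.

Lemma coincide_below_trans J I L :
  coincide_below I J -> coincide_below J L -> coincide_below I L.
Proof.
have tr (X Y Z : rinterval R) :
    (forall t, rset X t -> exists2 s, rset Y s & s <= t) ->
    (forall t, rset Y t -> exists2 s, rset Z s & s <= t) ->
    forall t, rset X t -> exists2 s, rset Z s & s <= t.
  move=> XY YZ t /XY[s /YZ[u Zu us] st]; exists u => //; exact: le_trans st.
by case=> IJ JI [JL LJ]; split; [exact: tr IJ JL|exact: tr LJ JI].
Qed.

Lemma coincide_above_sym I J : coincide_above I J -> coincide_above J I.
Proof. by case. Qed.

Lemma coincide_above_trans J I L :
  coincide_above I J -> coincide_above J L -> coincide_above I L.
Proof.
have tr (X Y Z : rinterval R) :
    (forall s, rset X s -> exists2 t, rset Y t & s <= t) ->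
    (forall s, rset Y s -> exists2 t, rset Z t & s <= t) ->
    forall s, rset X s -> exists2 t, rset Z t & s <= t.
  move=> XY YZ t /XY[s /YZ[u Zu us] st]; exists u => //; exact: le_trans us.
by case=> JI IJ [LJ JL]; split; [exact: tr LJ JI|exact: tr IJ JL].
Qed.

(** The common point [t] answers for all points of [I] to its right, so only those up to [t] matter.
    If the bounds were in the wrong order, a separating real would lie in [I] but before all of
    [J]. *)
Lemma lower_le_coincide I J t : rset I t -> rset J t ->
  (lower_bound J <= lower_bound I)%O <->
  (forall s, rset I s -> exists2 s', rset J s' & s' <= s).
Proof.
move=> It Jt; have [_ Iu] := iffLR (rset_bounds I t) It.
have [Jl Ju] := iffLR (rset_bounds J t) Jt; split=> [JI s|IJ].
  move=> /rset_bounds[Is _]; have [st|ts] := leP s t; last first.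
    by exists t => //; exact: ltW.
  exists s => //; apply/rset_bounds; split; first exact: le_trans Is.
  by apply: le_trans Ju; rewrite bnd_simp.
rewrite leNgt; apply/negP => /lower_sep/(_ Jl)[s st [Is sJ]].
have [|s' /rset_bounds[Js' _] s's] := IJ s.
  apply/rset_bounds; split=> //; apply: le_trans Iu; by rewrite bnd_simp.
have := lt_le_trans sJ Js'; rewrite bnd_simp ltNge s's //.
Qed.

Lemma coincide_below_lower I J t : rset I t -> rset J t ->
  coincide_below I J <-> lower_bound I = lower_bound J.
Proof.
move=> It Jt; rewrite /coincide_below -(lower_le_coincide It Jt).
rewrite -(lower_le_coincide Jt It); split=> [[JI IJ]|->]; last by rewrite lexx.
by apply: le_anti; rewrite IJ JI.
Qed.

Lemma upper_le_coincide I J t : rset I t -> rset J t ->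
  (upper_bound I <= upper_bound J)%O <->
  (forall s, rset I s -> exists2 s', rset J s' & s <= s').
Proof.
move=> It Jt; have [Il _] := iffLR (rset_bounds I t) It.
have [Jl Ju] := iffLR (rset_bounds J t) Jt; split=> [IJ s|IJ].
  move=> /rset_bounds[_ Is]; have [ts|st] := leP t s; last first.
    by exists t => //; exact: ltW.
  exists s => //; apply/rset_bounds; split; last exact: le_trans IJ.
  by apply: le_trans Jl _; rewrite bnd_simp.
rewrite leNgt; apply/negP => /upper_sep/(_ Ju)[s ts [Js sI]].
have [|s' /rset_bounds[_ Js'] ss'] := IJ s.
  apply/rset_bounds; split=> //; apply: le_trans Il _; by rewrite bnd_simp.
have := le_lt_trans Js' Js; rewrite bnd_simp ltNge ss' //.
Qed.

Lemma coincide_above_upper I J t : rset I t -> rset J t ->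
  coincide_above I J <-> upper_bound I = upper_bound J.
Proof.
move=> It Jt; rewrite /coincide_above -(upper_le_coincide It Jt).
rewrite -(upper_le_coincide Jt It); split=> [[JI IJ]|->]; last by rewrite lexx.
by apply: le_anti; rewrite IJ JI.
Qed.

(** For equal lower bounds, strict inclusion amounts to strict comparison of upper bounds. Hence the
    order used by the induced matching inside a class is the enumeration order. *)
Lemma bar_lt_lower b c : lower_bound b.1 = lower_bound c.1 ->
  bar_lt b c <-> epi_lt b c.
Proof.
case: b c => [I m] [J n] /= lE; rewrite /bar_lt /epi_lt /= lE ltxx.
have IJ : (rset J `<` rset I) <-> (upper_bound J < upper_bound I)%O.
  rewrite properEneq; split=> [[/eqP JI JsI]|ult].
    rewrite ltNge; apply/negP => uIJ; apply: JI; apply/seteqP; split=> //.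
    move=> s /rset_bounds[Il Iu]; apply/rset_bounds.
    by rewrite -lE; split=> //; exact: le_trans uIJ.
  split; first by apply/eqP => E; move: ult; rewrite /upper_bound E ltxx.
  move=> s /rset_bounds[Jl Ju]; apply/rset_bounds.
  by rewrite lE; split=> //; exact: le_trans (ltW ult).
rewrite IJ; split=> [[|[-> mn]]|[//|[_ [|[uE mn]]]]]; auto.
by right; rewrite (rinterval_eq lE uE).
Qed.

Lemma bar_lt_upper b c : upper_bound b.1 = upper_bound c.1 ->
  bar_lt b c <-> mono_lt b c.
Proof.
case: b c => [I m] [J n] /= uE; rewrite /bar_lt /mono_lt /= uE ltxx.
have IJ : (rset J `<` rset I) <-> (lower_bound I < lower_bound J)%O.
  rewrite properEneq; split=> [[/eqP JI JsI]|llt].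
    rewrite ltNge; apply/negP => lJI; apply: JI; apply/seteqP; split=> //.
    move=> s /rset_bounds[Il Iu]; apply/rset_bounds.
    by rewrite -uE; split=> //; exact: le_trans Il.
  split; first by apply/eqP => E; move: llt; rewrite /lower_bound E ltxx.
  move=> s /rset_bounds[Jl Ju]; apply/rset_bounds.
  by rewrite uE; split=> //; apply: le_trans Jl; exact: ltW.
rewrite IJ; split=> [[|[-> mn]]|[//|[_ [|[lE mn]]]]]; auto.
by right; rewrite (rinterval_eq lE uE).
Qed.

Lemma bar_lt_at b c t : bar_lt b c -> rset c.1 t -> rset b.1 t.
Proof. by case=> [[+ _]|[->]] //; exact. Qed.

End Bounds.

(** * Cardinalities as counts, and positions in a finite list *)

Lemma card_count (T : choiceType) (X : set T) (s : seq T) (p : pred T) (n : nat) :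
    uniq s -> (forall y, X y <-> y \in s /\ p y) ->
  (X #= `I_n)%card <-> count p s = n.
Proof.
move=> us XE; pose F := finmap.seq_fset tt [seq x <- s | p x].
have -> : X = [set` F].
  apply/seteqP; split=> y /=; rewrite /F finmap.seq_fsetE mem_filter.
    by case/XE => -> ->.
  by case/andP => py ys; apply/XE.
have <- : size (finmap.enum_fset F) = count p s.
  by rewrite finmap.size_seq_fset undup_id ?filter_uniq // size_filter.
by split=> /card_eq_fsetP.
Qed.

Lemma count_add (T : eqType) (p q r : pred T) (s : seq T) :
  {in s, forall y, p y = q y + r y :> nat}%N ->
  count p s = (count q s + count r s)%N.
Proof.
elim: s => //= y s IH pqr; rewrite pqr ?mem_head // IH 1?addnACA // => z zs.
by rewrite pqr // inE zs orbT.
Qed.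

Section Position.
Variables (T : eqType) (lt : T -> T -> Prop).
Hypothesis lt_irr : forall x, ~ lt x x.
Hypothesis lt_trans : forall y x z, lt x y -> lt y z -> lt x z.
Hypothesis lt_total : forall x y, x <> y -> lt x y \/ lt y x.

Definition upto (x y : T) : bool := `[< y = x \/ lt y x >].

(** For [x] in [s] this counts from 1, as [x] itself is included; this agrees with [is_ith]. *)
Definition position (s : seq T) (x : T) : nat := count (upto x) s.

Lemma upto_refl x : upto x x.
Proof. by apply/asboolP; left. Qed.

Lemma position_gt0 s x : x \in s -> (0 < position s x)%N.
Proof. by move=> xs; rewrite -has_count; apply/hasP; exists x; rewrite ?upto_refl. Qed.

Lemma position_lt s x y : y \in s -> lt x y -> (position s x < position s y)%N.
Proof.
move=> ys xy; rewrite /position.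
have -> : count (upto y) s =
    (count (upto x) s + count (fun z => upto y z && ~~ upto x z) s)%N.
  apply: count_add => z _; case: (asboolP (z = x \/ lt z x)) => zx.
    have -> : upto y z by apply/asboolP; right; case: zx => [->|/lt_trans]; auto.
    by rewrite /upto asboolT.
  by rewrite /(upto x z) asboolF // andbT.
rewrite -addn1 leq_add2l -has_count; apply/hasP; exists y => //.
rewrite upto_refl; apply/asboolP => -[yx|yx]; first by apply: (@lt_irr x); rewrite -{2}yx.
exact/(@lt_irr x)/(lt_trans xy yx).
Qed.

(** Positions strictly increase along [lt], so those of the members of [s] are distinct. Lying
    between 1 and [size s], they exhaust this range. *)
Lemma position_surj s k : uniq s -> (0 < k <= size s)%N ->
  exists2 x, x \in s & position s x = k.
Proof.
move=> us ks; pose l := map (position s) s.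
have ul : uniq l.
  rewrite map_inj_in_uniq // => x y xs ys xy; apply: contrapT => /lt_total[] h.
    by have := position_lt ys h; rewrite xy ltnn.
  by have := position_lt xs h; rewrite xy ltnn.
have sub : {subset l <= iota 1 (size s)}.
  move=> _ /mapP[x xs ->]; rewrite mem_iota position_gt0 //= add1n ltnS.
  exact: count_size.
have [_ lE] := uniq_min_size ul sub ltac:(by rewrite size_iota size_map).
have : k \in l by rewrite lE mem_iota; lia.
by case/mapP => x xs ->; exists x.
Qed.

End Position.

(** * Classes cut out by a nested family of tests *)

Section Classes.
Variables (T : choiceType) (lt : T -> T -> Prop).
Hypothesis lt_irr : forall x, ~ lt x x.
Hypothesis lt_trans : forall y x z, lt x y -> lt y z -> lt x z.
Hypothesis lt_total : forall x y, x <> y -> lt x y \/ lt y x.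
Variables (S : Type) (leS : rel S) (inn : S -> pred T).
Hypothesis leS_total : total leS.
Hypothesis inn_mono : forall s s' x, leS s s' -> inn s x -> inn s' x.

(* In the application, T is the type of bars and [inn s x] says that x extends at
   least as far as s, from t towards the end by which bars are first sorted;
   [leS s s'] says that s' is nearer to t. *)
Definition before (x y : T) := exists2 s, inn s x & ~~ inn s y.
Definition same (x y : T) := forall s, inn s x = inn s y.

Hypothesis before_lt : forall x y, before x y -> lt x y.

Lemma before_total x y : ~ before x y -> ~ before y x -> same x y.
Proof.
move=> xy yx s; apply/idP/idP => h.
  by apply/negPn/negP => h'; apply: xy; exists s.
by apply/negPn/negP => h'; apply: yx; exists s.
Qed.

Lemma same_before x y : same x y -> ~ before x y.
Proof. by move=> xy [s]; rewrite xy => ->. Qed.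

Lemma same_sym x y : same x y -> same y x. Proof. by move=> xy s. Qed.

Lemma same_trans y x z : same x y -> same y z -> same x z.
Proof. by move=> xy yz s; rewrite xy. Qed.

(** Each [b] before [c] has its own witness; as the tests are nested and [l] is finite, the weakest
    of these witnesses serves for all. Thus the elements before [c] are counted by a single test. *)
Lemma before_sep c (l : seq T) : (exists s, ~~ inn s c) ->
  exists2 s, ~~ inn s c & {in l, forall b, inn s b <-> before b c}.
Proof.
move=> ex; suff [s sc sl] :
    exists2 s, ~~ inn s c & {in l, forall b, before b c -> inn s b}.
  by exists s => // b bl; split=> [bs|]; [exists s|exact: sl].
elim: l => [|b l [s sc sl]]; first by case: ex => s sc; exists s.
have [[s' bs' cs']|nbc] := pselect (before b c); last first.
  by exists s => // x; rewrite inE => /predU1P[->|/sl].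
have [ss'|s's] := orP (leS_total s s').
  by exists s' => // x; rewrite inE => /predU1P[->//|/sl xl /xl]; exact: inn_mono.
exists s => // x; rewrite inE => /predU1P[-> _|/sl //].
exact: inn_mono bs'.
Qed.

(** Dually, the strictest of finitely many tests passed by [c] excludes everything after [c]. *)
Lemma after_sep c (l : seq T) : (exists s, inn s c) ->
  exists2 s, inn s c & {in l, forall b, inn s b <-> ~ before c b}.
Proof.
move=> ex; suff [s sc sl] :
    exists2 s, inn s c & {in l, forall b, inn s b -> ~ before c b}.
  exists s => // b bl; split=> [|nb]; first exact: sl.
  by apply/negPn/negP => sb; apply: nb; exists s.
elim: l => [|b l [s sc sl]]; first by case: ex => s sc; exists s.
have [[s' bs' cs']|nbc] := pselect (before c b); last first.
  by exists s => // x; rewrite inE => /predU1P[->|/sl].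
have [ss'|s's] := orP (leS_total s s').
  exists s => // x; rewrite inE => /predU1P[->|/sl //].
  by move=> /(inn_mono ss') /(negP cs').
exists s' => // x; rewrite inE => /predU1P[->|/sl xl]; first by rewrite (negPf cs').
by move=> /(inn_mono s's).
Qed.

Definition class_position (X : seq T) (x : T) : nat :=
  count (fun y => `[< same y x >] && upto lt x y) X.

Lemma class_position_gt0 (X : seq T) x : x \in X -> (0 < class_position X x)%N.
Proof.
move=> xX; rewrite -has_count; apply/hasP; exists x => //.
by rewrite upto_refl andbT; apply/asboolP.
Qed.

(** Since [lt] refines [before], earlier classes count in full and later ones not at all. *)
Lemma position_class (X : seq T) x :
  position lt X x = (count (fun y => `[< before y x >]) X + class_position X x)%N.
Proof.
apply: count_add => y _.
have [yx|nyx] := pselect (before y x).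
  rewrite (asboolT yx) (asboolF (P := same y x)); last by move/same_before; exact.
  by rewrite /upto asboolT //; right; exact: before_lt.
rewrite (asboolF nyx) add0n.
have [xy|nxy] := pselect (before x y).
  rewrite (asboolF (P := same y x)); last by move=> /same_sym /same_before; exact.
  rewrite /upto asboolF // => -[yE|yx].
    by apply: (@same_before x y) xy; rewrite yE => s.
  exact/(@lt_irr x)/(lt_trans (before_lt xy) yx).
by rewrite asboolT //; exact: before_total.
Qed.

(** [A] and [C] will list the bars at [t] of the module with larger ranks and of the one with
    smaller ranks: source and target of an epimorphism, target and source of a monomorphism. The two
    hypotheses on counts are then the rank inequalities. *)
Variables A C : seq T.
Hypotheses (uA : uniq A) (uC : uniq C).
Hypothesis count_le : forall s, (count (inn s) C <= count (inn s) A)%N.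
Hypothesis count_mono : forall s s', leS s s' ->
  (count (inn s) A + count (inn s') C <= count (inn s') A + count (inn s) C)%N.

Lemma count_before (X : seq T) c s :
    {in X, forall b, inn s b <-> before b c} ->
  count (fun y => `[< before y c >]) X = count (inn s) X.
Proof. by move=> sE; apply: eq_in_count => y yX; apply/asboolP/idP => /(sE _ yX). Qed.

Lemma count_before0 (X : seq T) c : ~ (exists s, ~~ inn s c) ->
  count (fun y => `[< before y c >]) X = 0%N.
Proof.
move=> nex; rewrite (@eq_count _ _ pred0) ?count_pred0 // => y.
by apply/asboolF => -[s _ sc]; apply: nex; exists s.
Qed.

Lemma count_not_after (X : seq T) c s :
    {in X, forall b, inn s b <-> ~ before c b} ->
  count (inn s) X = (count (fun y => `[< before y c >]) X
                     + count (fun y => `[< same y c >]) X)%N.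
Proof.
move=> sE; apply: count_add => y yX.
have [yc|nyc] := pselect (before y c).
  rewrite (asboolT yc) (asboolF (P := same y c)); last by move/same_before; exact.
  have -> // : inn s y; apply/(sE _ yX) => cy.
  exact/(@lt_irr y)/(lt_trans (before_lt yc))/before_lt.
rewrite (asboolF nyc) add0n; congr nat_of_bool; apply/idP/asboolP.
  by move/(sE _ yX); exact: before_total.
by move/same_sym/same_before => ?; apply/(sE _ yX).
Qed.

Lemma in_catl (P : T -> Prop) : {in A ++ C, forall x, P x} -> {in A, forall x, P x}.
Proof. by move=> PAC x xA; apply: PAC; rewrite mem_cat xA. Qed.

Lemma in_catr (P : T -> Prop) : {in A ++ C, forall x, P x} -> {in C, forall x, P x}.
Proof. by move=> PAC x xC; apply: PAC; rewrite mem_cat xC orbT. Qed.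

(** The size of the class is the difference between the counts for a test selecting what is not
    after [c] and for one selecting what is before [c]; [count_mono] compares these differences. If
    [c] passes every test, nothing is before it and [count_le] suffices. *)
Lemma class_count_le c : (exists s, inn s c) ->
  (count (fun y => `[< same y c >]) C <= count (fun y => `[< same y c >]) A)%N.
Proof.
move=> /(after_sep (A ++ C))[s1 s1c s1E].
have sA := count_not_after (in_catl s1E); have sC := count_not_after (in_catr s1E).
have [ex|nex] := pselect (exists s, ~~ inn s c); last first.
  by have := count_le s1; rewrite sA sC !count_before0.
have [s0 s0c s0E] := before_sep (A ++ C) ex.
have s01 : leS s0 s1.
  have [//|s10] := orP (leS_total s0 s1).
  by rewrite (inn_mono s10) in s0c.
have := count_mono s01; rewrite sA sC.
by rewrite (count_before (in_catl s0E)) (count_before (in_catr s0E)); lia.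
Qed.

Lemma class_match c : c \in C -> (exists s, inn s c) ->
  exists b, [/\ b \in A, same b c & class_position A b = class_position C c].
Proof.
move=> cC ex.
have [|b] := @position_surj T lt lt_irr lt_trans lt_total
    [seq y <- A | `[< same y c >]] (class_position C c) (filter_uniq _ uA).
  apply/andP; split; first exact: class_position_gt0.
  rewrite size_filter; apply: leq_trans (class_count_le ex).
  by apply: sub_count => y /andP[].
rewrite mem_filter => /andP[/asboolP bc bA] <-; exists b; split=> //.
rewrite /position count_filter; apply: eq_count => y /=; rewrite andbC; congr andb.
by apply/asbool_equiv_eq; split=> h; apply: same_trans h _ => // s; rewrite bc.
Qed.

(** The class positions cancel, leaving the numbers of elements before [c] in [A] and in [C]. One
    test [s0] computes both and attains the maximum: stricter tests give no larger difference by
    [count_mono], and weaker ones that [c] still fails select the same elements. *)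
Lemma position_shift b c : c \in C -> same b c ->
    class_position A b = class_position C c ->
  is_max0 [set d : int | exists s : S, (count (inn s) C < position lt C c)%N /\
             d = (count (inn s) A)%:Z - (count (inn s) C)%:Z]
    ((position lt A b)%:Z - (position lt C c)%:Z).
Proof.
move=> cC bc kE; rewrite !position_class kE.
have -> : count (fun y => `[< before y b >]) A = count (fun y => `[< before y c >]) A.
  apply: eq_count => y; apply/asbool_equiv_eq.
  by split=> -[s ys ns]; exists s => //; [rewrite -bc|rewrite bc].
have k0 := class_position_gt0 cC.
(* If [c] passed [s], so would everything up to [c], and the count would reach the position of
   [c]. *)
have low s : (count (inn s) C <
    count (fun y => `[< before y c >]) C + class_position C c)%N -> ~~ inn s c.
  apply: contraL => sc; rewrite -leqNgt -position_class.
  rewrite /position -!size_filter uniq_leq_size ?filter_uniq // => y.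
  rewrite !mem_filter => /andP[/asboolP yc yC]; rewrite yC andbT.
  case: yc => [->//|yc]; apply/negPn/negP => sy.
  by apply/(@lt_irr c)/(lt_trans _ yc)/before_lt; exists s.
have [ex|nex] := pselect (exists s, ~~ inn s c); last first.
  (* When [c] passes every test, the maximum is over the empty set; its default 0 is right because
     nothing is before [c]. *)
  left; split; last by rewrite !count_before0 // subrr.
  by apply/seteqP; split=> // d [s [/low sc _]]; case: nex; exists s.
have [s0 s0c s0E] := before_sep (A ++ C) ex; right.
have bA := count_before (in_catl s0E); have bC := count_before (in_catr s0E).
rewrite bA bC; split; first by exists s0; split; lia.
move=> _ [s [slt ->]]; have sc : ~~ inn s c by apply: low; rewrite bC.
have [/count_mono|s0s] := orP (leS_total s s0); first lia.
have sE : {in A ++ C, forall y, inn s y <-> before y c}.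
  by move=> y yX; split=> [ys|/(s0E _ yX)]; [exists s|exact: inn_mono].
by rewrite -(count_before (in_catl sE)) -(count_before (in_catr sE)) bA bC; lia.
Qed.

End Classes.

(** * The induced matching at [t] in terms of counts *)

Section Matching.
Variables (R : realType) (BM BN : set (bar R)) (t : R).
Variables (coin : rinterval R -> rinterval R -> Prop) (lt : bar R -> bar R -> Prop).
Hypothesis lt_irr : forall x, ~ lt x x.
Hypothesis lt_trans : forall y x z, lt x y -> lt y z -> lt x z.
Hypothesis lt_total : forall x y, x <> y -> lt x y \/ lt y x.
Variables (S : Type) (leS : rel S) (inn : S -> pred (bar R)).
Hypothesis leS_total : total leS.
Hypothesis inn_mono : forall s s' x, leS s s' -> inn s x -> inn s' x.
Hypothesis before_lt : forall x y, before inn x y -> lt x y.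
Hypothesis coin_sym : forall I J, coin I J -> coin J I.
Hypothesis coin_trans : forall J I L, coin I J -> coin J L -> coin I L.
Hypothesis coin_same : forall b c, rset b.1 t -> rset c.1 t ->
  coin b.1 c.1 <-> same inn b c.
Hypothesis bar_ltE : forall b c, rset b.1 t -> rset c.1 t -> same inn b c ->
  bar_lt b c <-> lt b c.
Hypothesis inn_at : forall b, rset b.1 t -> exists s, inn s b.

(** Common form of [X_epi] and [X_mono], which are the instances for [coincide_below] and
    [coincide_above]. *)
Definition class_match_rel (B1 B2 : set (bar R)) : set (bar R * bar R) :=
  [set p | exists (I : rinterval R) (i : nat),
     is_ith (@bar_lt R) (bars_in B1 (coin I)) i p.1 /\
     is_ith (@bar_lt R) (bars_in B2 (coin I)) i p.2].

Lemma is_ith_position (B : set (bar R)) (A : seq (bar R)) i b : uniq A ->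
    (forall b, b \in A <-> bars_at B t b) ->
  is_ith lt (bars_at B t) i b <-> b \in A /\ position lt A b = i.
Proof.
move=> uA AE; rewrite /is_ith -AE /position.
rewrite -(card_count (X := [set y | bars_at B t y /\ (y = b \/ lt y b)]) i uA) //.
by move=> y /=; rewrite -AE; split=> -[yA] /asboolP.
Qed.

(** The left side ranks [b] in its class within the whole barcode, the right side among the bars at
    [t] only. These agree because a bar earlier in the class contains [b] as an interval, hence
    contains [t]. *)
Lemma is_ith_class_position (B : set (bar R)) (A : seq (bar R)) I i b :
    uniq A -> (forall b, b \in A <-> bars_at B t b) -> b \in A ->
  is_ith (@bar_lt R) (bars_in B (coin I)) i b <->
  coin I b.1 /\ class_position lt inn A b = i.
Proof.
move=> uA AE /[dup] bA /AE[Bb bt].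
have cardE : coin I b.1 ->
  ([set y | bars_in B (coin I) y /\ (y = b \/ bar_lt y b)] #= `I_i)%card <->
  class_position lt inn A b = i.
  move=> Ib; apply: card_count => // y; split.
    move=> [[By Iy] yb].
    have yt : rset y.1 t by case: yb => [->|/bar_lt_at]; auto.
    have yb' : same inn y b.
      by apply/coin_same => //; apply: coin_trans Ib; exact: coin_sym.
    split; first by apply/AE.
    rewrite (asboolT yb'); apply/asboolP.
    by case: yb => [|/(bar_ltE yt bt yb')]; auto.
  move=> [/AE[By yt] /andP[/asboolP yb /asboolP ylt]]; split.
    split=> //; apply: (coin_trans Ib); apply: coin_sym; exact/coin_same.
  by case: ylt => [|/(bar_ltE yt bt yb)]; auto.
split=> [[[_ Ib] /cardE]|[Ib /(cardE Ib)]]; last by [].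
by move/(_ Ib).
Qed.

Variables A C : seq (bar R).
Hypotheses (uA : uniq A) (uC : uniq C).
Hypothesis AE : forall b, b \in A <-> bars_at BM t b.
Hypothesis CE : forall b, b \in C <-> bars_at BN t b.
Hypothesis count_le : forall s, (count (inn s) C <= count (inn s) A)%N.
Hypothesis count_mono : forall s s', leS s s' ->
  (count (inn s) A + count (inn s') C <= count (inn s') A + count (inn s) C)%N.

Lemma class_match_relE b c : b \in A -> c \in C ->
  class_match_rel BM BN (b, c) <->
  same inn b c /\ class_position lt inn A b = class_position lt inn C c.
Proof.
move=> bA cC; have [_ bt] := iffLR (AE b) bA; have [_ ct] := iffLR (CE c) cC.
split=> [[I [i [/= bi ci]]]|[bc kE]].
  have [Ib kb] := iffLR (is_ith_class_position I i uA AE bA) bi.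
  have [Ic kc] := iffLR (is_ith_class_position I i uC CE cC) ci.
  split; last by rewrite kb.
  by apply/coin_same => //; apply: coin_trans Ic; exact: coin_sym.
have bcc : coin b.1 c.1 by apply/coin_same.
exists c.1, (class_position lt inn C c); split=> /=.
  by apply/(is_ith_class_position _ _ uA AE bA); split=> //; exact: coin_sym.
apply/(is_ith_class_position _ _ uC CE cC); split=> //.
exact: coin_trans (coin_sym bcc) bcc.
Qed.

Lemma is_max0_unique (D : set int) m m' : is_max0 D m -> is_max0 D m' -> m = m'.
Proof.
case=> [[-> ->]|[Dm mmax]] [[D0 ->]|[Dm' mmax']] //.
  by rewrite D0 in Dm.
by apply: le_anti; rewrite mmax ?mmax'.
Qed.

(** A matched pair satisfies the formula by [position_shift]. Conversely, some [c] sits at position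
    [j], [class_match] provides its partner, and uniqueness of the maximum forces the partner to sit
    at position [i]. *)
Lemma enum_matchE : enum_match lt BM BN (class_match_rel BM BN) t =
  [set ij : nat * nat | [/\ (0 < ij.1)%N, (0 < ij.2)%N, (ij.2 <= size C)%N
    & exists2 m : int,
        is_max0 [set d : int | exists s : S, (count (inn s) C < ij.2)%N /\
                   d = (count (inn s) A)%:Z - (count (inn s) C)%:Z] m
      & (ij.1)%:Z = (ij.2)%:Z + m]].
Proof.
apply/seteqP; split=> -[i j] /=.
  move=> [b [c [/= /(is_ith_position _ _ uA AE)[bA <-] [bcX _ _]]]].
  move=> /(is_ith_position _ _ uC CE)[cC <-].
  have [bc kE] := iffLR (class_match_relE bA cC) bcX.
  split; rewrite ?position_gt0 ?count_size //.
  exists ((position lt A b)%:Z - (position lt C c)%:Z); last lia.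
  exact: position_shift.
move=> [i0 j0 jC [m mmax ijm]].
have [|c cC cj] := position_surj lt_irr lt_trans lt_total uC (k := j).
  by rewrite j0.
have [_ ct] := iffLR (CE c) cC.
have [b [bA bc kE]] := class_match lt_irr lt_trans lt_total leS_total inn_mono
  before_lt uA uC count_le count_mono cC (inn_at ct).
have [_ bt] := iffLR (AE b) bA.
exists b, c; split=> /=.
- apply/(is_ith_position _ _ uA AE); split=> //.
  have := position_shift lt_irr lt_trans leS_total inn_mono before_lt uA uC
    count_mono cC bc kE.
  rewrite cj => /(is_max0_unique mmax) mE.
  by apply/eqP; rewrite -eqz_nat ijm mE addrC subrK; exact: eqxx.
- by split=> //; apply/class_match_relE.
- by apply/(is_ith_position _ _ uC CE).
Qed.

End Matching.

(** * The two formulas *)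

Section Main.
Variables (R : realType) (K : fieldType).

Lemma D_epiE (M N : pmodule R K) (f : pmorphism M N) (BM BN : set (bar R))
    (barM : is_barcode M BM) (barN : is_barcode N BN) (t : R) :
  epimorphism f ->
  D_epi BM BN t =
     [set ij : nat * nat |
       [/\ (0 < ij.1)%N, (0 < ij.2)%N, (ij.2 <= \dim {:N t})%N
         & exists2 m : int,
             is_max0 [set d : int | exists (s : R) (st : s < t),
                        (prank N (ltW st) < ij.2)%N /\
                        d = (prank M (ltW st))%:Z - (prank N (ltW st))%:Z] m
             & (ij.1)%:Z = (ij.2)%:Z + m]].
Proof.
move=> fepi; have [A uA AE] := barcode_bars_at barM t.
have [C uC CE] := barcode_bars_at barN t.
(* The tests are the parameters up to [t]. Including [t] itself ensures that every bar at [t] passes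
   some test. [inn] looks at lower bounds alone, so it is monotone on all bars; for bars at [t] it
   means containing [s]. *)
pose S := {s : R | s <= t}; pose leS : rel S := fun s s' => val s <= val s'.
pose inn (s : S) (b : bar R) := (lower_bound b.1 <= BLeft (val s))%O.
have innE (s : S) b : rset b.1 t -> inn s b <-> rset b.1 (val s).
  move=> /rset_bounds[_ bt]; split=> [sb|/rset_bounds[] //].
  apply/rset_bounds; split=> //; apply: le_trans bt; rewrite bnd_simp.
  exact: valP s.
have prankE (P : pmodule R K) B X (s : S) (st : val s <= t) :
    is_barcode P B -> uniq X ->
    (forall b, b \in X <-> bars_at B t b) -> prank P st = count (inn s) X.
  move=> barP uX XE; rewrite -size_filter.
  apply: (barcode_prank barP); rewrite ?filter_uniq // => b.
  rewrite mem_filter; split=> [/andP[sb /XE[Bb bt]]|[[Bb bt] bs]].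
    by split=> //; apply/innE.
  by apply/andP; split; [apply/innE|apply/XE].
have AP s st := prankE M BM A s st barM uA AE.
have CP s st := prankE N BN C s st barN uC CE.
have dimC : \dim {:N t} = size C.
  rewrite -(dim_prank N (lexx t)) (barcode_prank barN (lexx t) uC) // => b.
  by rewrite CE; split=> [[]|[]].
have sameE b c : rset b.1 t -> rset c.1 t ->
    same inn b c <-> lower_bound b.1 = lower_bound c.1.
  move=> bt ct; split=> [bc|lE s]; last by rewrite /inn lE.
  apply: le_anti; rewrite !leNgt; apply/andP; split; apply/negP => /lower_sep.
    have [bl _] := iffLR (rset_bounds _ _) bt => /(_ _ bl)[s st [sc sb]].
    by move: (bc (exist _ s st)); rewrite /inn /= sc leNgt sb.
  have [cl _] := iffLR (rset_bounds _ _) ct => /(_ _ cl)[s st [sb sc]].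
  by move: (bc (exist _ s st)); rewrite /inn /= sb leNgt sc.
(* The extra test [t] does not affect the set of differences: its count is [size C], which is not
   below [j]. *)
have dE j : (j <= size C)%N ->
    [set d : int | exists s : S, (count (inn s) C < j)%N /\
       d = (count (inn s) A)%:Z - (count (inn s) C)%:Z] =
    [set d : int | exists (s : R) (st : s < t), (prank N (ltW st) < j)%N /\
       d = (prank M (ltW st))%:Z - (prank N (ltW st))%:Z].
  move=> jC; apply/seteqP; split=> d /=; last first.
    move=> [s [st]]; pose s' : S := exist _ s (ltW st).
    by rewrite (AP s' (ltW st)) (CP s' (ltW st)); exists s'.
  move=> [s []]; have [st|ts] := ltP (val s) t.
    by rewrite -(AP s (ltW st)) -(CP s (ltW st)) => sj ->; exists (val s), st.
  have -> : count (inn s) C = size C.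
    apply/eqP; rewrite -all_count; apply/allP => b /CE[_ bt]; apply/innE => //.
    by have /eqP -> : val s == t by rewrite eq_le ts (valP s).
  by rewrite ltnNge jC.
have leS_total : total leS by move=> s s'; exact: le_total.
have inn_mono s s' b : leS s s' -> inn s b -> inn s' b.
  by move=> ss' /le_trans; apply; rewrite bnd_simp; exact: ss'.
have before_lt b c : before inn b c -> epi_lt b c.
  by move=> [s sb]; rewrite /inn -ltNge => sc; left; exact: le_lt_trans sc.
have coin_same b c : rset b.1 t -> rset c.1 t ->
    coincide_below b.1 c.1 <-> same inn b c.
  by move=> bt ct; rewrite sameE //; exact: coincide_below_lower bt ct.
have bar_ltE b c : rset b.1 t -> rset c.1 t -> same inn b c ->
    bar_lt b c <-> epi_lt b c.
  by move=> bt ct /(sameE _ _ bt ct); exact: bar_lt_lower.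
have inn_at b : rset b.1 t -> exists s, inn s b.
  by move=> bt; exists (exist _ t (lexx t)); apply/innE.
have count_le s : (count (inn s) C <= count (inn s) A)%N.
  by rewrite -(AP s (valP s)) -(CP s (valP s)); exact: epi_prank_le fepi.
have count_mono s s' : leS s s' ->
    (count (inn s) A + count (inn s') C <= count (inn s') A + count (inn s) C)%N.
  by move=> ss'; rewrite -(AP s (valP s)) -(AP s' (valP s')) -(CP s (valP s))
    -(CP s' (valP s')); exact: epi_prank_mono fepi.
have /= := enum_matchE (@epi_lt_irr R) (@epi_lt_trans R) (@epi_lt_total R)
  leS_total inn_mono before_lt (@coincide_below_sym R) (@coincide_below_trans R)
  coin_same bar_ltE inn_at uA uC AE CE count_le count_mono.
rewrite /D_epi => ->; rewrite dimC; apply/seteqP.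
by split=> -[i j] /= [i0 j0 jC]; rewrite dE.
Qed.

Lemma D_monoE (M N : pmodule R K) (f : pmorphism M N) (BM BN : set (bar R))
    (barM : is_barcode M BM) (barN : is_barcode N BN) (t : R) :
  monomorphism f ->
  D_mono BM BN t =
     [set ij : nat * nat |
       [/\ (0 < ij.1)%N, (0 < ij.2)%N, (ij.1 <= \dim {:M t})%N
         & exists2 m : int,
             is_max0 [set d : int | exists (v : R) (tv : t < v),
                        (prank M (ltW tv) < ij.1)%N /\
                        d = (prank N (ltW tv))%:Z - (prank M (ltW tv))%:Z] m
             & (ij.2)%:Z = (ij.1)%:Z + m]].
Proof.
(* The roles are exchanged: [A] comes from the target [N], [C] from the source [M]. The order of
   tests is reversed too, since smaller [v] are nearer to [t]. *)
move=> fmono; have [A uA AE] := barcode_bars_at barN t.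
have [C uC CE] := barcode_bars_at barM t.
pose S := {v : R | t <= v}; pose leS : rel S := fun v v' => val v' <= val v.
pose inn (v : S) (b : bar R) := (BRight (val v) <= upper_bound b.1)%O.
have innE (v : S) b : rset b.1 t -> inn v b <-> rset b.1 (val v).
  move=> /rset_bounds[bt _]; split=> [vb|/rset_bounds[] //].
  apply/rset_bounds; split=> //; apply: le_trans bt _; rewrite bnd_simp.
  exact: valP v.
have prankE (P : pmodule R K) B X (v : S) (tv : t <= val v) :
    is_barcode P B -> uniq X ->
    (forall b, b \in X <-> bars_at B t b) -> prank P tv = count (inn v) X.
  move=> barP uX XE; rewrite -size_filter.
  apply: (barcode_prank barP); rewrite ?filter_uniq // => b.
  rewrite mem_filter; split=> [/andP[vb /XE[Bb bt]]|[[Bb bv] bt]].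
    by split=> //; split=> //; apply/innE.
  by apply/andP; split; [apply/innE|apply/XE].
have AP v tv := prankE N BN A v tv barN uA AE.
have CP v tv := prankE M BM C v tv barM uC CE.
have dimC : \dim {:M t} = size C.
  rewrite -(dim_prank M (lexx t)) (barcode_prank barM (lexx t) uC) // => b.
  by rewrite CE; split=> [[]|[]].
have sameE b c : rset b.1 t -> rset c.1 t ->
    same inn b c <-> upper_bound b.1 = upper_bound c.1.
  move=> bt ct; split=> [bc|uE v]; last by rewrite /inn uE.
  apply: le_anti; rewrite !leNgt; apply/andP; split; apply/negP => /upper_sep.
    have [_ cu] := iffLR (rset_bounds _ _) ct => /(_ _ cu)[v tv [vc vb]].
    by move: (bc (exist _ v tv)); rewrite /inn /= vb leNgt vc.
  have [_ bu] := iffLR (rset_bounds _ _) bt => /(_ _ bu)[v tv [vb vc]].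
  by move: (bc (exist _ v tv)); rewrite /inn /= vc leNgt vb.
have dE j : (j <= size C)%N ->
    [set d : int | exists v : S, (count (inn v) C < j)%N /\
       d = (count (inn v) A)%:Z - (count (inn v) C)%:Z] =
    [set d : int | exists (v : R) (tv : t < v), (prank M (ltW tv) < j)%N /\
       d = (prank N (ltW tv))%:Z - (prank M (ltW tv))%:Z].
  move=> jC; apply/seteqP; split=> d /=; last first.
    move=> [v [tv]]; pose v' : S := exist _ v (ltW tv).
    by rewrite (AP v' (ltW tv)) (CP v' (ltW tv)); exists v'.
  move=> [v []]; have [tv|vt] := ltP t (val v).
    by rewrite -(AP v (ltW tv)) -(CP v (ltW tv)) => vj ->; exists (val v), tv.
  have -> : count (inn v) C = size C.
    apply/eqP; rewrite -all_count; apply/allP => b /CE[_ bt]; apply/innE => //.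
    by have /eqP -> : val v == t by rewrite eq_le vt (valP v).
  by rewrite ltnNge jC.
have leS_total : total leS by move=> v v'; exact: le_total.
have inn_mono v v' b : leS v v' -> inn v b -> inn v' b.
  by move=> vv'; apply: le_trans; rewrite bnd_simp; exact: vv'.
have before_lt b c : before inn b c -> mono_lt b c.
  by move=> [v vb]; rewrite /inn -ltNge => vc; left; exact: lt_le_trans vb.
have coin_same b c : rset b.1 t -> rset c.1 t ->
    coincide_above b.1 c.1 <-> same inn b c.
  by move=> bt ct; rewrite sameE //; exact: coincide_above_upper bt ct.
have bar_ltE b c : rset b.1 t -> rset c.1 t -> same inn b c ->
    bar_lt b c <-> mono_lt b c.
  by move=> bt ct /(sameE _ _ bt ct); exact: bar_lt_upper.
have inn_at b : rset b.1 t -> exists v, inn v b.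
  by move=> bt; exists (exist _ t (lexx t)); apply/innE.
have count_le v : (count (inn v) C <= count (inn v) A)%N.
  by rewrite -(AP v (valP v)) -(CP v (valP v)); exact: mono_prank_le fmono.
have count_mono v v' : leS v v' ->
    (count (inn v) A + count (inn v') C <= count (inn v') A + count (inn v) C)%N.
  by move=> vv'; rewrite -(AP v (valP v)) -(AP v' (valP v')) -(CP v (valP v))
    -(CP v' (valP v')); exact: mono_prank_mono fmono.
have matchE := enum_matchE (@mono_lt_irr R) (@mono_lt_trans R) (@mono_lt_total R)
  leS_total inn_mono before_lt (@coincide_above_sym R) (@coincide_above_trans R)
  coin_same bar_ltE inn_at uA uC AE CE count_le count_mono.
(* [enum_matchE] goes from the larger list to the smaller one, so it describes the converse of the
   matching sought. *)
have swapE i j : D_mono BM BN t (i, j) <->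
    enum_match (@mono_lt R) BN BM (class_match_rel (@coincide_above R) BN BM) t (j, i).
  split=> -[b [c [/= ib [[I [k [kb kc]]] tb tc] jc]]].
    by exists c, b; split=> //; split=> //; exists I, k.
  by exists c, b; split=> //; split=> //; exists I, k.
rewrite dimC; apply/seteqP; split=> -[i j] /=.
  by move=> /swapE; rewrite matchE /= => -[j0 i0 iC]; rewrite dE.
by move=> [i0 j0 iC]; rewrite -dE // => h; apply/swapE; rewrite matchE.
Qed.

End Main.

Theorem proposition5p4 (R : realType) (K : fieldType) (M N : pmodule R K)
    (f : pmorphism M N) (BM BN : set (bar R))
    (barM : is_barcode M BM) (barN : is_barcode N BN) (t : R) :
  (epimorphism f ->
     D_epi BM BN t =
     [set ij : nat * nat |
       [/\ (0 < ij.1)%N, (0 < ij.2)%N, (ij.2 <= \dim {:N t})%N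
         & exists2 m : int,
             is_max0 [set d : int | exists (s : R) (st : s < t),
                        (prank N (ltW st) < ij.2)%N /\
                        d = (prank M (ltW st))%:Z - (prank N (ltW st))%:Z] m
             & (ij.1)%:Z = (ij.2)%:Z + m]]) /\
  (monomorphism f ->
     D_mono BM BN t =
     [set ij : nat * nat |
       [/\ (0 < ij.1)%N, (0 < ij.2)%N, (ij.1 <= \dim {:M t})%N
         & exists2 m : int,
             is_max0 [set d : int | exists (v : R) (tv : t < v),
                        (prank M (ltW tv) < ij.1)%N /\
                        d = (prank N (ltW tv))%:Z - (prank M (ltW tv))%:Z] m
             & (ij.2)%:Z = (ij.1)%:Z + m]]).
Proof. by split; [exact: D_epiE | exact: D_monoE]. Qed.
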